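(* Let $L\subset\mathbb{Z}^n$ be a lattice. If $L$ is positive and $F$ is an $I_L$-fiber, then $\overline F=\{F\}$.
   Context: Let $\mathbb{N}=\mathbb{Z}_{\ge0}$. A lattice is a subgroup $L\subset\mathbb{Z}^n$; it is positive if $L\cap\mathbb{N}^n=\{\mathbf 0\}$. An $I_L$-fiber is a set of monomials in $x_1,\ldots,x_n$ of the form $F_u=\{x^v:v\in\mathbb{N}^n,\ v-u\in L\}$ with $u\in\mathbb{N}^n$. Fibers $F,G$ are equivalent if there are $u,v\in\mathbb{N}^n$ with $x^uF\subset G$ and $x^vG\subset F$; $\overline F$ denotes the equivalence class of $F$ (a set of fibers). *)

(* Defs.v *)
From mathcomp Require Import all_boot all_order all_algebra.
From mathcomp Require Export mpoly.
From mathcomp Require Export boolp classical_sets.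

Set Implicit Arguments.
Unset Strict Implicit.
Unset Printing Implicit Defensive.

Import GRing.Theory Num.Theory.

Local Open Scope ring_scope.
Local Open Scope classical_set_scope.

(* The type ['X_{1..n}] stands both for NN^n and for the monomials in n
   variables: [v] is the exponent vector of x^v, and the product x^u x^v is
   [(u + v)%MM]. *)

(* The inclusion of NN^n in ZZ^n. *)
Definition mnmZ (n : nat) (v : 'X_{1..n}) : 'rV[int]_n := \row_i (v i)%:Z.

(* A lattice is a subgroup of ZZ^n, i.e. a [zmodClosed 'rV[int]_n]; membership
   is boolean, which is no restriction in the classical setting of [boolp]. *)
Definition positive_lattice (n : nat) (L : zmodClosed 'rV[int]_n) : Prop :=
  [set` L] `&` range (@mnmZ n) = [set 0].

Definition fiber_of (n : nat) (L : zmodClosed 'rV[int]_n) (u : 'X_{1..n}) :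
    set 'X_{1..n} :=
  [set v | mnmZ v - mnmZ u \in L].

Definition is_fiber (n : nat) (L : zmodClosed 'rV[int]_n)
    (F : set 'X_{1..n}) : Prop :=
  exists u : 'X_{1..n}, F = fiber_of L u.

Definition mnm_translate (n : nat) (u : 'X_{1..n}) (F : set 'X_{1..n}) :
    set 'X_{1..n} :=
  [set (u + v)%MM | v in F].

Definition fiber_equiv (n : nat) (F G : set 'X_{1..n}) : Prop :=
  exists u v : 'X_{1..n}, mnm_translate u F `<=` G /\ mnm_translate v G `<=` F.

Definition fiber_class (n : nat) (L : zmodClosed 'rV[int]_n)
    (F : set 'X_{1..n}) : set (set 'X_{1..n}) :=
  [set G | is_fiber L G /\ fiber_equiv F G].

(* Main.v *)
Require Import Defs.
From mathcomp Require Import all_boot all_order all_algebra.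
Import GRing.Theory Num.Theory.
Local Open Scope ring_scope.
Local Open Scope classical_set_scope.

(** If [x^u F] lies in [G] and [x^v G] lies in [F], then multiplication by
    [x^(u + v)] maps [F] into itself.  Two elements of a fiber differ by a
    lattice vector, so applying this to any element of [F] shows that [u + v]
    is in the lattice.  It is also a vector of natural numbers, hence it
    vanishes by positivity; as nothing cancels in NN^n, both [u] and [v] vanish,
    and the two inclusions become [F `<=` G] and [G `<=` F]. *)

Lemma mnmZD (n : nat) (u v : 'X_{1..n}) :
  mnmZ (u + v)%MM = mnmZ u + mnmZ v.
Proof. by apply/rowP => i; rewrite !mxE mnmDE PoszD. Qed.

Lemma mnmZ_eq0 (n : nat) (u : 'X_{1..n}) : mnmZ u = 0 -> u = 0%MM.
Proof.
move=> u0; apply/mnmP => i; rewrite mnm0E.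
by have /rowP/(_ i) := u0; rewrite !mxE => -[].
Qed.

Lemma mnmD_eq0 (n : nat) (u v : 'X_{1..n}) :
  (u + v)%MM = 0%MM -> u = 0%MM /\ v = 0%MM.
Proof.
move=> uv0; have h i : (u i == 0%N) && (v i == 0%N).
  by rewrite -addn_eq0 -mnmDE uv0 mnm0E.
by split; apply/mnmP => i; rewrite mnm0E; have /andP[/eqP ? /eqP ?] := h i.
Qed.

Lemma positive_lattice_mnmZ (n : nat) (L : zmodClosed 'rV[int]_n)
    (w : 'X_{1..n}) :
  positive_lattice L -> mnmZ w \in L -> w = 0%MM.
Proof.
move=> hL wL; apply: mnmZ_eq0.
have : ([set` L] `&` range (@mnmZ n)) (mnmZ w) by split => //; exists w.
by rewrite hL.
Qed.

Lemma fiber_of_refl (n : nat) (L : zmodClosed 'rV[int]_n) (u : 'X_{1..n}) :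
  fiber_of L u u.
Proof. by rewrite /fiber_of /= subrr rpred0. Qed.

Lemma mnm_translate0 (n : nat) (F : set 'X_{1..n}) :
  mnm_translate 0%MM F = F.
Proof.
apply/seteqP; split => [_ [w Fw <-]|w Fw]; first by rewrite add0m.
by exists w => //; rewrite add0m.
Qed.

Lemma fiber_equiv_refl (n : nat) (F : set 'X_{1..n}) : fiber_equiv F F.
Proof. by exists 0%MM, 0%MM; rewrite mnm_translate0; split. Qed.

Lemma fiber_equiv_eq (n : nat) (L : zmodClosed 'rV[int]_n)
    (F G : set 'X_{1..n}) :
  positive_lattice L -> is_fiber L F -> fiber_equiv F G -> G = F.
Proof.
move=> hL [a Fa] [u [v [uFG vGF]]].
have Fvua : F (v + (u + a))%MM.
  apply: vGF; exists (u + a)%MM => //; apply: uFG; exists a => //.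
  by rewrite Fa; exact: fiber_of_refl.
have vu0 : (v + u)%MM = 0%MM.
  apply: (positive_lattice_mnmZ _ _ _ hL).
  by move: Fvua; rewrite Fa /fiber_of /= addmA mnmZD addrK.
have [v0 u0] := mnmD_eq0 _ _ _ vu0.
move: uFG vGF; rewrite u0 v0 !mnm_translate0 => FG GF.
by apply/seteqP; split.
Qed.

Theorem lemma3p3 (n : nat) (L : zmodClosed 'rV[int]_n)
    (hL : positive_lattice L) (F : set 'X_{1..n}) (hF : is_fiber L F) :
  fiber_class L F = [set F].
Proof.
apply/seteqP; split => [G [_ FG]|_ ->].
  exact: (fiber_equiv_eq _ _ _ _ hL hF FG).
by split; [exact: hF | exact: fiber_equiv_refl].
Qed.
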